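(* For all integers $n\ge0$, one has $a(12n+11)\equiv 0\pmod 3$.
   Context: For a positive integer $n$, $a(n)$ is the signed number of partitions of $n$ into exactly two distinct part sizes, each occurring an odd number of times: $$a(n)=\sum (-1)^{r_1+r_2},$$ the sum being over all quadruples of integers $(x,y,r_1,r_2)$ with $1\le x<y$, $r_1,r_2\ge 0$ and $(2r_1+1)x+(2r_2+1)y=n$. *)

(* Defs.v *)
From mathcomp Require Import all_boot all_order all_algebra.
From mathcomp Require Import zify.

Set Implicit Arguments.
Unset Strict Implicit.
Unset Printing Implicit Defensive.

Import GRing.Theory.
Local Open Scope ring_scope.

Definition two_size_odd (n x y r1 r2 : nat) : bool :=
  [&& 1 <= x, x < y & (2 * r1 + 1) * x + (2 * r2 + 1) * y == n]%N.

(* Every solution has x, y, r1, r2 <= n (two_size_odd_bound), so the ordinal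
   ranges only make the sum finite. *)
Definition a (n : nat) : int :=
  \sum_(x < n.+1) \sum_(y < n.+1) \sum_(r1 < n.+1)
    \sum_(r2 < n.+1 | two_size_odd n x y r1 r2) (-1) ^+ (r1 + r2)%N.

Lemma two_size_odd_bound (n x y r1 r2 : nat) :
  two_size_odd n x y r1 r2 ->
  [/\ x < n.+1, y < n.+1, r1 < n.+1 & r2 < n.+1]%N.
Proof. by case/and3P=> x_gt0 ltxy /eqP <-; split; nia. Qed.

(* Main.v *)
(* Liouville's method. With chi the nontrivial character mod 4 and
   F m = cos (m pi / 2), one has 2 chi(u) chi(v) = F(u - v) - F(u + v), so that
   for odd n the number 4 a(n) is the sum of F(u - v) - F(u + v) over all
   positive solutions of u x + v y = n (the solutions with x = y contribute
   nothing). Unimodular substitutions in (u, x, v, y) reduce this sum to its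
   boundary terms, where u = v or x = y, and for n = 3 mod 4 they amount to
   4 a(n) = sum over d | n of (d - chi d). If n = 11 mod 12, then d and n / d
   contribute together a multiple of 3. *)

Require Import Defs.
From mathcomp Require Import all_boot all_order all_algebra.
From mathcomp Require Import zify ring lra.

Set Implicit Arguments.
Unset Strict Implicit.
Unset Printing Implicit Defensive.

Import Order.TTheory GRing.Theory Num.Theory.
Local Open Scope ring_scope.

(** * Reindexing, and the finite list of positive solutions *)

(** The maps need only be mutually inverse on the selected entries: the substitutions below use
    truncated subtraction and are not bijective on all quadruples. *)
Lemma sum_reindex (T U : eqType) (V : nmodType) (s : seq T) (t : seq U)
    (P : pred T) (Q : pred U) (F : T -> V) (G : U -> V)
    (f : T -> U) (g : U -> T) :
    uniq s -> uniq t ->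
    (forall p, p \in s -> P p ->
       [/\ f p \in t, Q (f p), g (f p) = p & F p = G (f p)]) ->
    (forall q, q \in t -> Q q -> [/\ g q \in s, P (g q) & f (g q) = q]) ->
  \sum_(p <- s | P p) F p = \sum_(q <- t | Q q) G q.
Proof.
move=> us ut fP gP; rewrite -big_filter -[RHS]big_filter.
have peq : perm_eq (map f (filter P s)) (filter Q t).
  apply: uniq_perm; last move=> q.
  - rewrite map_inj_in_uniq ?filter_uniq // => p1 p2.
    rewrite !mem_filter => /andP[P1 s1] /andP[P2 s2] eqf.
    by have [_ _ <- _] := fP _ s1 P1; rewrite eqf; have [_ _ -> _] := fP _ s2 P2.
  - exact: filter_uniq.
  rewrite mem_filter; apply/mapP/andP => [[p]|[Qq tq]].
    by rewrite mem_filter => /andP[Pp sp] ->; have [] := fP _ sp Pp.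
  have [sg Pg fg] := gP _ tq Qq.
  by exists (g q); rewrite ?mem_filter ?Pg.
rewrite -(perm_big _ peq) big_map !big_filter big_seq_cond [RHS]big_seq_cond.
by apply: eq_bigr => p /andP[sp Pp]; have [] := fP _ sp Pp.
Qed.

Definition box (N : nat) : seq (nat * nat) :=
  [seq (i, j) | i <- iota 0 N, j <- iota 0 N].

Lemma mem_box N p : (p \in box N) = (p.1 < N)%N && (p.2 < N)%N.
Proof.
case: p => i j /=; apply/allpairsP/andP => [[[u v] /= []]|[iN jN]].
  by rewrite !mem_iota /= => uN vN [-> ->].
by exists (i, j); rewrite /= !mem_iota.
Qed.

Lemma box_uniq N : uniq (box N).
Proof. by apply: allpairs_uniq; rewrite ?iota_uniq // => -[? ?] [? ?]. Qed.

Definition box2 (N : nat) : seq (nat * nat * (nat * nat)) :=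
  [seq (p, q) | p <- box N, q <- box N].

Lemma mem_box2 N p : (p \in box2 N) =
  [&& p.1.1 < N, p.1.2 < N, p.2.1 < N & p.2.2 < N]%N.
Proof.
case: p => p q /=; rewrite andbA -!mem_box.
apply/allpairsP/andP => [[[u v] /= []]|[pN qN]]; last by exists (p, q).
by move=> uN vN [-> ->].
Qed.

Lemma box2_uniq N : uniq (box2 N).
Proof. by apply: allpairs_uniq; rewrite ?box_uniq // => -[? ?] [? ?]. Qed.

Lemma sum_box2 (V : nmodType) N (P : nat -> nat -> nat -> nat -> bool)
    (F : nat -> nat -> nat -> nat -> V) :
  \sum_(i < N) \sum_(j < N) \sum_(k < N) \sum_(l < N | P i j k l) F i j k l =
  \sum_(p <- box2 N | P p.1.1 p.1.2 p.2.1 p.2.2) F p.1.1 p.1.2 p.2.1 p.2.2.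
Proof.
rewrite [RHS]big_mkcond /= big_allpairs big_allpairs.
have iotaE (G : nat -> V) : \sum_(i <- iota 0 N) G i = \sum_(i < N) G i.
  by rewrite -(big_mkord predT) /index_iota subn0.
rewrite iotaE; apply: eq_bigr => i _; rewrite iotaE; apply: eq_bigr => j _.
rewrite big_allpairs iotaE; apply: eq_bigr => k _.
by rewrite iotaE [LHS]big_mkcond.
Qed.

(* [((u, x), (v, y))] stands for the solution [u x + v y = n]. *)
Definition sols (n : nat) : seq (nat * nat * (nat * nat)) :=
  [seq p <- box2 n.+1 | [&& 0 < p.1.1, 0 < p.1.2, 0 < p.2.1, 0 < p.2.2
                          & p.1.1 * p.1.2 + p.2.1 * p.2.2 == n]%N].

Lemma sols_uniq n : uniq (sols n).
Proof. exact/filter_uniq/box2_uniq. Qed.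

(** Positivity bounds each unknown by [n], so the cutoff of the box drops out. *)
Lemma mem_sols n u x v y : (((u, x), (v, y)) \in sols n) =
  [&& 0 < u, 0 < x, 0 < v, 0 < y & u * x + v * y == n]%N.
Proof.
rewrite mem_filter mem_box2 /=; apply/andb_idr => /and5P[? ? ? ? /eqP <-].
by apply/and4P; split; nia.
Qed.

(** * The character modulo 4 as a sine, and its product formula *)

Definition chi (m : nat) : int := if odd m then (-1) ^+ m./2 else 0.

(* [cosq m] is cos (m pi / 2). *)
Definition cosq (m : nat) : int := if odd m then 0 else (-1) ^+ m./2.

Lemma cosq_odd m : odd m -> cosq m = 0.
Proof. by rewrite /cosq => ->. Qed.

(** As [chi m] is sin (m pi / 2), this is the product formula for sines; the first argument is |u -
    v| in truncated subtraction. *)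
Lemma cosq_sub_add u v :
  cosq (u - v + (v - u)) - cosq (u + v) = 2 * (chi u * chi v).
Proof.
wlog le_vu : u v / (v <= u)%N => [wl|].
  case/orP: (leq_total v u) => /wl //.
  by rewrite addnC [(v + u)%N]addnC [chi v * _]mulrC.
have [w ->] : exists w, u = (v + w)%N by exists (u - v)%N; lia.
have -> : (v + w - v + (v - (v + w)) = w)%N by lia.
have -> : (v + w + v = w + v.*2)%N by lia.
rewrite /cosq /chi !oddD odd_double addbF.
(* The arguments w and w + 2v have equal parity. If w is odd, both cosines vanish and one of v + w,
   v is even; if w is even, the cosines differ by the factor (-1)^v. *)
case: (boolP (odd w)) => ow; first by case: (odd v); rewrite subrr ?mulr0 ?mul0r.
rewrite addbF !halfD (negPf ow) odd_double !andbF doubleK !add0n !exprD.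
rewrite -(signr_odd _ v); case: (odd v); last by rewrite mulr1 subrr mulr0.
rewrite mulrAC -[(-1) ^+ v./2 * _]expr2 sqrr_sign; ring.
Qed.

Lemma big_ltngt (T : Type) (V : nmodType) (s : seq T) (f g : T -> nat)
    (F : T -> V) :
  \sum_(p <- s) F p = \sum_(p <- s | (f p < g p)%N) F p +
    \sum_(p <- s | f p == g p) F p + \sum_(p <- s | (g p < f p)%N) F p.
Proof.
rewrite (big_mkcond (fun p => f p < g p)%N) (big_mkcond (fun p => f p == g p)).
rewrite (big_mkcond (fun p => g p < f p)%N) -!big_split /=; apply: eq_bigr => p _.
by case: ltngtP => _; rewrite ?addr0 ?add0r.
Qed.

Ltac solve_sols :=
  move=> [[u x] [v y]]; rewrite mem_sols /= => /and5P[? ? ? ? /eqP ?] ?;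
  split; rewrite ?mem_sols /=;
  try (by [lia | nia | apply/and5P; split; nia |
     congr (_, _, (_, _)); lia | congr (_ _); lia]).

(** * Liouville's identity and its boundary terms *)

Section Liouville.

Variables (F : nat -> int) (n : nat).

Local Notation U p := (p.1.1).
Local Notation X p := (p.1.2).
Local Notation W p := (p.2.1).
Local Notation Y p := (p.2.2).

(** The parts u < v and v < u each map onto the solutions with x < y, by u x + v y = (v - u) y + u
    (x + y) = (u - v) x + v (x + y). *)
Lemma sum_sols_dist :
  \sum_(p <- sols n) F (U p - W p + (W p - U p)) =
  \sum_(p <- sols n | U p == W p) F 0%N +
  (\sum_(p <- sols n | (X p < Y p)%N) F (U p)) *+ 2.
Proof.
rewrite (big_ltngt _ (fun p => U p) (fun p => W p)) mulr2n addrA.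
rewrite [Z in Z + _ = _]addrC; congr (_ + _ + _).
- by apply: eq_bigr => p /eqP ->; rewrite subnn.
- apply: (sum_reindex (f := fun p => ((W p - U p, Y p), (U p, X p + Y p)))
    (g := fun p => ((W p, Y p - X p), (U p + W p, X p)))%N);
    rewrite ?sols_uniq //; solve_sols.
- apply: (sum_reindex (f := fun p => ((U p - W p, X p), (W p, X p + Y p)))
    (g := fun p => ((U p + W p, X p), (W p, Y p - X p)))%N);
    rewrite ?sols_uniq //; solve_sols.
Qed.

(** The parts x < y and y < x each map onto the solutions with v < u, by u x + v y = (u + v) x + v
    (y - x) = (u + v) y + u (x - y). *)
Lemma sum_sols_add :
  \sum_(p <- sols n) F (U p + W p) =
  \sum_(p <- sols n | X p == Y p) F (U p + W p) +
  (\sum_(p <- sols n | (W p < U p)%N) F (U p)) *+ 2.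
Proof.
rewrite (big_ltngt _ (fun p => X p) (fun p => Y p)) mulr2n addrA.
rewrite [Z in Z + _ = _]addrC; congr (_ + _ + _).
- apply: (sum_reindex (f := fun p => ((U p + W p, X p), (W p, Y p - X p)))
    (g := fun p => ((U p - W p, X p), (W p, X p + Y p)))%N);
    rewrite ?sols_uniq //; solve_sols.
- apply: (sum_reindex (f := fun p => ((U p + W p, Y p), (U p, X p - Y p)))
    (g := fun p => ((W p, X p + Y p), (U p - W p, X p)))%N);
    rewrite ?sols_uniq //; solve_sols.
Qed.

(** The substitution u x + v y = u (x - y) + (u + v) y leaves u fixed. *)
Lemma sum_sols_exchange :
  \sum_(p <- sols n | (Y p < X p)%N) F (U p) =
  \sum_(p <- sols n | (U p < W p)%N) F (U p).
Proof.
apply: (sum_reindex (f := fun p => ((U p, X p - Y p), (U p + W p, Y p)))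
  (g := fun p => ((U p, X p + Y p), (W p - U p, Y p)))%N);
  rewrite ?sols_uniq //; solve_sols.
Qed.

Theorem liouville_identity :
  \sum_(p <- sols n) (F (U p - W p + (W p - U p)) - F (U p + W p)) =
  \sum_(p <- sols n | U p == W p) F 0%N
  - \sum_(p <- sols n | X p == Y p) F (U p + W p)
  + (\sum_(p <- sols n | U p == W p) F (U p)
     - \sum_(p <- sols n | X p == Y p) F (U p)) *+ 2.
Proof.
rewrite sumrB sum_sols_dist sum_sols_add !mulr2n.
(* Splitting the sum of F u by x, y and by u, v, the parts y < x and u < v cancel. Hence the x < y
   part minus the v < u part is the u = v part minus the x = y part. *)
have := big_ltngt (sols n) (fun p => X p) (fun p => Y p) (fun p => F (U p)).
rewrite (big_ltngt _ (fun p => U p) (fun p => W p)) sum_sols_exchange.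
by move=> E; lra.
Qed.

Lemma sum_sols_transpose (c : int) :
  \sum_(p <- sols n | U p == W p) c = \sum_(p <- sols n | X p == Y p) c.
Proof.
apply: (sum_reindex (f := fun p => ((X p, U p), (Y p, W p)))
  (g := fun p => ((X p, U p), (Y p, W p))));
  rewrite ?sols_uniq //; solve_sols.
Qed.

(** If x = y, then (u + v) x = n: the divisor is d = u + v, and u runs from 1 to d - 1. *)
Lemma sum_sols_divisors : (0 < n)%N ->
  \sum_(p <- sols n | X p == Y p) F (U p) =
  \sum_(d <- divisors n) \sum_(i <- iota 1 d.-1) F i.
Proof.
move=> n_gt0; rewrite -(big_allpairs_dep (h := pair) (F := fun q => F q.2)).
apply: (sum_reindex (f := fun p => (U p + W p, U p))
  (g := fun q => ((q.2, n %/ q.1), (q.1 - q.2, n %/ q.1)))%N).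
- exact: sols_uniq.
- apply: allpairs_uniq_dep => [|d _|]; rewrite ?divisors_uniq ?iota_uniq //.
  by move=> [d i] [d' i'] _ _ [-> ->].
- move=> [[u x] [v y]]; rewrite mem_sols /= => /and5P[u0 x0 v0 y0 /eqP <-].
  move/eqP=> <-; rewrite -mulnDl mulKn ?addn_gt0 ?u0 // addKn; split => //.
  apply/allpairsPdep; exists (u + v)%N, u; rewrite mem_iota -dvdn_divisors.
    by split=> //; [exact: dvdn_mulr | lia].
  by rewrite muln_gt0 addn_gt0 u0.
move=> [d i] /allpairsPdep[d' [i' []]]; rewrite -dvdn_divisors // mem_iota.
move=> dn /= bi [-> ->]; have d0 := dvdn_gt0 n_gt0 dn.
have q0 : (0 < n %/ d')%N by rewrite divn_gt0 // dvdn_leq.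
split=> //; last by rewrite subnKC //; lia.
rewrite mem_sols q0 -mulnDl subnKC ?[(d' * _)%N]mulnC ?divnK ?eqxx //; lia.
Qed.

End Liouville.

(** * From [a n] to a divisor sum *)

(** With u = 2 r1 + 1 and v = 2 r2 + 1, the part x < y is [a n], and y < x mirrors it. If x = y,
    then (u + v) x is odd, so u or v is even and the term vanishes. *)
Lemma sum_sols_chi n : odd n ->
  \sum_(p <- sols n) chi p.1.1 * chi p.2.1 = 2 * a n.
Proof.
move=> n_odd; have aE : a n =
    \sum_(p <- sols n | (p.1.2 < p.2.2)%N) chi p.1.1 * chi p.2.1.
  rewrite /a (sum_box2 _ (two_size_odd n) (fun _ _ i j => (-1) ^+ (i + j)%N)).
  rewrite [RHS](bigID (fun p => odd p.1.1 && odd p.2.1)) /=.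
  rewrite [X in _ + X]big1 ?addr0.
    apply: (sum_reindex
      (f := fun p => ((2 * p.2.1 + 1, p.1.1), (2 * p.2.2 + 1, p.1.2)))
      (g := fun p => ((p.1.2, p.2.2), (p.1.1./2, p.2.1./2)))%N).
    - exact: box2_uniq.
    - exact: sols_uniq.
    - move=> [[x y] [i j]] /= _ /and3P[? ? e].
      have o k : odd (2 * k + 1)%N by lia.
      have h k : (2 * k + 1)%N./2 = k by lia.
      by rewrite mem_sols e /chi !o !h exprD; split=> //; lia.
    move=> [[u x] [v y]]; rewrite mem_sols mem_box2 /two_size_odd /=.
    move=> /and5P[? ? ? ? /eqP e] /and3P[? ? ?]; split; first by nia.
      apply/and3P; split=> //; apply/eqP; rewrite -e.
      by congr (_ * _ + _ * _)%N; lia.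
    by congr (_, _, (_, _)); lia.
  by move=> p /andP[_]; rewrite /chi; case: odd; case: odd; rewrite ?mulr0 ?mul0r.
rewrite (big_ltngt _ (fun p => p.1.2) (fun p => p.2.2)) -aE.
rewrite [X in _ + X + _]big1_seq ?addr0.
  rewrite mulr_natl mulr2n; congr (_ + _); rewrite aE.
  apply: (sum_reindex (f := fun p => (p.2, p.1)) (g := fun p => (p.2, p.1)));
    rewrite ?sols_uniq //; last solve_sols.
  move=> [[u x] [v y]]; rewrite !mem_sols /= mulrC addnC.
  by move=> /and5P[-> -> -> -> ->].
move=> [[u x] [v y]] /= /andP[/eqP <-]; rewrite mem_sols.
case/and5P=> _ _ _ _ /eqP e; move: n_odd; rewrite -e -mulnDl oddM oddD /chi.
by case: odd; case: odd; rewrite ?mulr0 ?mul0r.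
Qed.

Lemma chi_mod4 m :
  chi m = if (m %% 4 == 1)%N then 1 else if (m %% 4 == 3)%N then -1 else 0.
Proof.
rewrite /chi -signr_odd.
have -> : odd m = (m %% 4 == 1)%N || (m %% 4 == 3)%N by lia.
have -> : odd m./2 = (m %% 4 == 2)%N || (m %% 4 == 3)%N by lia.
by case: (m %% 4)%N => [|[|[|[|?]]]].
Qed.

Lemma sum_one_sub_cosq d : odd d ->
  \sum_(i <- iota 1 d.-1) (1 - 2 * cosq i) = d%:Z - chi d.
Proof.
move=> d_odd; rewrite -(odd_double_half d) d_odd add1n /=.
(* The two new terms add 2 + 2 (-1)^m: d grows by 2 and [chi d] changes sign. *)
elim: {d d_odd}(d./2) => [|m IH] //; first by rewrite big_nil.
rewrite doubleS -addn2 iotaD big_cat IH /= big_cons big_seq1 add1n.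
rewrite addn2 /cosq /chi /= odd_double /= doubleK uphalf_double exprS.
by move: ((-1) ^+ m) => s; lia.
Qed.

Lemma four_a n : (n %% 4 = 3)%N ->
  4 * a n = \sum_(d <- divisors n) (d%:Z - chi d).
Proof.
move=> n3; have n_odd : odd n by lia.
have -> : 4 * a n =
    \sum_(p <- sols n) (cosq (p.1.1 - p.2.1 + (p.2.1 - p.1.1)) -
                        cosq (p.1.1 + p.2.1)).
  under eq_bigr do rewrite cosq_sub_add.
  by rewrite -mulr_sumr sum_sols_chi // mulrA.
rewrite liouville_identity sum_sols_transpose.
(* Two boundary sums vanish because [n] is odd: u + v divides [n] when x = y, and u divides [n] when
   u = v, so [cosq] is taken at odd arguments. *)
rewrite [X in _ - X + _]big1_seq; last first.
  move=> [[u x] [v y]] /= /andP[/eqP <-]; rewrite mem_sols.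
  case/and5P=> _ _ _ _ /eqP e; apply: cosq_odd.
  by move: n_odd; rewrite -e -mulnDl oddM => /andP[].
rewrite [X in _ + (X - _) *+ 2]big1_seq; last first.
  move=> [[u x] [v y]] /= /andP[/eqP <-]; rewrite mem_sols.
  case/and5P=> _ _ _ _ /eqP e; apply: cosq_odd.
  by move: n_odd; rewrite -e -mulnDr oddM => /andP[].
have n_gt0 : (0 < n)%N by lia.
rewrite subr0 sub0r (sum_sols_divisors (fun=> cosq 0)) // sum_sols_divisors //.
rewrite mulNrn -sumrMnl -sumrB [LHS]big_seq [RHS]big_seq; apply: eq_bigr => d.
rewrite -dvdn_divisors // => dn.
rewrite -sum_one_sub_cosq; last by apply: (dvdn_odd dn).
by rewrite sumrB -mulr_sumr mulr_natl.
Qed.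

(** * Pairing complementary divisors modulo 3 *)

Lemma sum_divisors_inv (V : nmodType) (n : nat) (G : nat -> V) : (0 < n)%N ->
  \sum_(d <- divisors n) G d = \sum_(d <- divisors n) G (n %/ d)%N.
Proof.
move=> n_gt0.
apply: (sum_reindex (f := fun d => n %/ d) (g := fun d => n %/ d)%N);
  rewrite ?divisors_uniq // => d; rewrite -!dvdn_divisors // => dn _.
  by rewrite divnA ?mulKn ?dvdn_div.
by rewrite divnA ?mulKn ?dvdn_div.
Qed.

Theorem theorem1p6 (n : nat) : (a (12 * n + 11)%N = 0 %[mod 3])%Z.
Proof.
set m := (12 * n + 11)%N.
have m_gt0 : (0 < m)%N by lia.
have m3 : (m %% 4 = 3)%N by lia.
(* Doubling allows the divisor sum to be added to its image under d -> m / d; the factor 8 is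
   invertible modulo 3. *)
have [] : (3 %| 2 * (4 * a m))%Z; last by lia.
rewrite four_a // mulr_natl mulr2n {2}sum_divisors_inv // -big_split /= big_seq.
apply: rpred_sum => d; rewrite -dvdn_divisors // => dn.
have [e de] : exists e, m = (d * e)%N by exists (m %/ d)%N; rewrite mulnC divnK.
have -> : (m %/ d = e)%N by rewrite de mulKn //; lia.
(* Since d e is 2 modulo 3, the residues of d and e are 1 and 2 in some order, so 3 divides d + e.
   Since d e is 3 modulo 4, they are 1 and 3 modulo 4, so the values of [chi] cancel. *)
have dm3 : ((d %% 3) * (e %% 3) = 2 %[mod 3])%N by rewrite modnMm -de; lia.
have dm4 : ((d %% 4) * (e %% 4) = 3 %[mod 4])%N by rewrite modnMm -de; lia.
have chi_de : chi d + chi e = 0.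
  move: dm4; rewrite !chi_mod4.
  have := ltn_pmod d (isT : 0 < 4)%N; have := ltn_pmod e (isT : 0 < 4)%N.
  by case: (d %% 4)%N => [|[|[|[|?]]]] //; case: (e %% 4)%N => [|[|[|[|?]]]].
have de3 : (3 %| d + e)%N.
  rewrite /dvdn -modnDm; move: dm3.
  have := ltn_pmod d (isT : 0 < 3)%N; have := ltn_pmod e (isT : 0 < 3)%N.
  by case: (d %% 3)%N => [|[|[|?]]] //; case: (e %% 3)%N => [|[|[|?]]].
by rewrite addrACA -opprD chi_de subr0.
Qed.
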